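(* Let $p,q,r$ be integers with $p\ge r>0$, $q>0$ and $p\equiv -1\pmod q$. Then: (1) if $1\le [r]_{2q}\le q$, then $NC(p,q;r,q)=\gcd([r]_{2q},\,q+1)$; (2) if $q+1\le [r]_{2q}\le 2q-1$, then $NC(p,q;r,q)=\gcd([r]_{2q}-2,\,q-1)$; (3) if $r<q$, then $NC(p,q;r,-q)=\gcd(r,\,1-q)$.
   Context: For positive integers $p\ge r>0$ and integers $q,s$, the twisted torus link $T(p,q;r,s)$ is the closure of the braid on $p$ strands $(\sigma_1\sigma_2\cdots\sigma_{p-1})^q(\sigma_1\cdots\sigma_{r-1})^s$, where $\sigma_1,\dots,\sigma_{p-1}$ are the standard generators of the braid group on $p$ strands (an empty product is the trivial braid). $NC(p,q;r,s)$ denotes the number of components of the link $T(p,q;r,s)$. For an integer $x$ and a positive integer $m$, $[x]_m\in\{0,1,\dots,m-1\}$ denotes the residue of $x$ modulo $m$. The gcd is taken non-negative, with $\gcd(a,0)=|a|$. *)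

(* Defs.v *)
From HB Require Import structures.
From mathcomp Require Import all_boot all_order all_algebra finmap.
From mathcomp Require Import all_classical all_reals all_analysis.

Set Implicit Arguments.
Unset Strict Implicit.
Unset Printing Implicit Defensive.

Import Order.TTheory GRing.Theory Num.Theory.
Import numFieldNormedType.Exports.

Local Open Scope classical_set_scope.
Local Open Scope ring_scope.

(* Braid words: (i, true) stands for sigma_i and (i, false) for its inverse.
   Strand positions are numbered 1, ..., p, so that the generators on p strands
   are sigma_1, ..., sigma_(p-1), and sigma_i exchanges positions i and i+1. *)
Definition braid_word := seq (nat * bool).

Definition inv_word (w : braid_word) : braid_word :=
  rev [seq (l.1, ~~ l.2) | l <- w].

Definition exp_word (w : braid_word) (n : int) : braid_word :=
  match n with
  | Posz m => flatten (nseq m w)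
  | Negz m => flatten (nseq m.+1 (inv_word w))
  end.

(* sigma_1 sigma_2 ... sigma_(m-1) *)
Definition sigma_row (m : nat) : braid_word := [seq (i, true) | i <- iota 1 m.-1].

Definition twisted_torus_word (p : nat) (q : int) (r : nat) (s : int) :
    braid_word :=
  exp_word (sigma_row p) q ++ exp_word (sigma_row r) s.

Section Closure.
Variable R : realType.

Definition pt3 (x y z : R) : 'rV[R]_3 := \row_(i < 3) [:: x; y; z]`_i.

Definition segment3 (P Q : 'rV[R]_3) : set 'rV[R]_3 :=
  [set (1 - t) *: P + t *: Q | t in `[0, 1]%classic].

Fixpoint polyline (P : 'rV[R]_3) (s : seq 'rV[R]_3) : set 'rV[R]_3 :=
  if s is Q :: s' then segment3 P Q `|` polyline Q s' else [set P].

(* The part, between the heights z = k and z = k + 1, of the strand starting at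
   position j, for a k-th letter l.  At a crossing the two strands pass the line
   x = i + 1/2 at y = 1 and y = -1 respectively; the sign of the generator says
   which one is in front. *)
Definition strand (k : nat) (l : nat * bool) (j : nat) : set 'rV[R]_3 :=
  let: (i, b) := l in
  let e : R := if b then 1 else -1 in
  let mid y := pt3 (i%:R + 2^-1) y (k%:R + 2^-1) in
  let bot x := pt3 x%:R 0 k%:R in
  let top x := pt3 x%:R 0 k.+1%:R in
  if j == i then polyline (bot i) [:: mid e; top i.+1]
  else if j == i.+1 then polyline (bot i.+1) [:: mid (- e); top i]
  else polyline (bot j) [:: top j].

(* The arc, in the plane y = 0 and to the right of the braid, that joins the
   top end (j, 0, n) of position j to its bottom end (j, 0, 0); for different j
   these arcs are nested. *)
Definition closing_arc (p n j : nat) : set 'rV[R]_3 :=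
  let h : R := (p.+1 - j)%:R in
  polyline (pt3 j%:R 0 n%:R)
    [:: pt3 j%:R 0 (n%:R + h); pt3 (p%:R + h) 0 (n%:R + h);
        pt3 (p%:R + h) 0 (- h); pt3 j%:R 0 (- h); pt3 j%:R 0 0].

Definition closed_braid (p : nat) (w : braid_word) : set 'rV[R]_3 :=
  \bigcup_(j in [set j : nat | (1 <= j <= p)%N])
    (closing_arc p (size w) j
     `|` \bigcup_(k in `I_(size w)) strand k (nth (0%N, true) w k) j).

Definition twisted_torus_link (p : nat) (q : int) (r : nat) (s : int) :
    set 'rV[R]_3 :=
  closed_braid p (twisted_torus_word p q r s).

Definition components (L : set 'rV[R]_3) : set (set 'rV[R]_3) :=
  [set connected_component L x | x in L].

(* [fset_set] sends infinite sets to the empty set, but a closed braid is a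
   finite union of segments, hence has finitely many components. *)
Definition NC (p : nat) (q : int) (r : nat) (s : int) : nat :=
  #|` fset_set (components (twisted_torus_link p q r s))|%fset.

End Closure.

(* Main.v *)
(** The components of a closed braid are the cycles of its permutation: the
threads that run up the braid from the positions of one cycle and return along
the closing arcs form a connected set, and distinct cycles give disjoint closed
sets.

The inverse of the permutation of T(p,q;r,s) is, on {0, ..., p-1}, the rotation
of {0, ..., r-1} by s followed by the rotation of {0, ..., p-1} by q.  Since
p = -1 mod q, a point that climbs from above r in steps of q re-enters {0, ..., q-1}
shifted by 1.  Below r, for s = q, points climb in steps of 2q.  Following the
orbits until they return to a suitable interval of length d gives a translation
of Z/d by some t, hence gcd(d,t) cycles: (d,t) is (rho, q+1) or (2q-rho, 1-q),
where rho = r mod 2q, according to whether rho <= q or rho > q, and (r, s+1) when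
r <= q and the rotation of {0, ..., r-1} is by an arbitrary s. *)

Require Import Defs.
From mathcomp Require Import all_boot all_order all_algebra finmap.
From mathcomp Require Import all_classical all_reals all_analysis.
From mathcomp Require Import lra zify.
From Stdlib Require Import Relation_Operators Operators_Properties.

Set Implicit Arguments.
Unset Strict Implicit.
Unset Printing Implicit Defensive.

Import Order.TTheory GRing.Theory Num.Theory.
Import numFieldNormedType.Exports.

(** * Orbits of products of two rotations *)

Local Open Scope nat_scope.

Definition orbit_eq (p : nat) (f : nat -> nat) : nat -> nat -> Prop :=
  clos_refl_sym_trans nat (fun x y => x < p /\ y = f x).

(** [lab] is a complete invariant of the orbits and [rep] a section of it: invariance separates
    orbits, and the last clause keeps two orbits from sharing a label. This counts orbits without
    forming a quotient. *)
Definition has_orbits (p : nat) (f : nat -> nat) (g : nat) : Prop :=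
  exists lab rep : nat -> nat,
    [/\ forall y, y < p -> lab y < g /\ lab (f y) = lab y,
        forall c, c < g -> rep c < p /\ lab (rep c) = c
      & forall y, y < p -> orbit_eq p f y (rep (lab y))].

(** Reduces a congruence to an equation with explicit multipliers, within reach of [lia]. *)
Lemma eqmod_shift (g x y i j : nat) : x + i * g = y + j * g -> x = y %[mod g].
Proof. by move=> e; rewrite -(modnMDl i x) addnC e addnC modnMDl. Qed.

(** [a] is [-b] modulo [n]; this trades a negative translation for a natural number. *)
Lemma gcdn_complement (a b c n : nat) : a + b = c * n -> gcdn n a = gcdn n b.
Proof.
move=> e; apply/eqP; rewrite eqn_dvd !dvdn_gcd !dvdn_gcdl /=.
have dn k : gcdn n k %| a + b by rewrite e dvdn_mull // dvdn_gcdl.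
by rewrite -(dvdn_addr _ (dvdn_gcdr n a)) dn -(dvdn_addl _ (dvdn_gcdr n b)) dn.
Qed.

(* Bezout: some multiple of t is -gcd(d, t) modulo d. *)
Lemma translation_orbits (E : nat -> nat -> Prop) (d t : nat) :
  (forall x, E x x) -> (forall x y z, E x y -> E y z -> E x z) ->
  0 < d -> (forall x, x < d -> E x ((x + t) %% d)) ->
  forall x, x < d -> E x (x %% gcdn d t).
Proof.
move=> Er Et d0 Es.
have En n x : x < d -> E x ((x + n * t) %% d).
  move=> xd; elim: n => [|n IH]; first by rewrite mul0n addn0 modn_small.
  apply: Et IH _; have := Es _ (ltn_pmod (x + n * t) d0).
  by rewrite modnDml -addnA (addnC _ t) -mulSn.
have g0 : 0 < gcdn d t by rewrite gcdn_gt0 d0.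
have [a _ /dvdnP[b ab]] := Bezoutr t d0.
rewrite gcdnC in ab.
move=> x; elim/ltn_ind: x => x IH xd.
case: (ltnP x (gcdn d t)) => xg; first by rewrite modn_small //.
have step : (x + a * t) %% d = x - gcdn d t.
  have -> : x + a * t = b * d + (x - gcdn d t) by lia.
  by rewrite modnMDl modn_small //; lia.
apply: Et (En a x xd) _; rewrite step.
have -> : x %% gcdn d t = (x - gcdn d t) %% gcdn d t.
  by rewrite -{1}(subnK xg) modnDr.
by apply: IH; lia.
Qed.

(** * Reducing the orbit count to positions below [r] or below [q] *)

Section TwoRotations.

Variables (p q r m : nat) (B : nat -> nat).
Hypotheses (r_gt0 : 0 < r) (le_rp : r <= p) (q_gt0 : 0 < q) (p1E : p.+1 = m * q).
Hypothesis B_lt : forall y, y < r -> B y < r.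
Hypothesis B_id : forall y, r <= y -> B y = y.

Let h y := (B y + q) %% p.

Let p_gt0 : 0 < p. Proof. exact: leq_trans le_rp. Qed.

Section Labelling.

Variable L : nat -> nat.
Hypothesis L_wrap : forall w, r <= w < q -> L (w.+1 %% q) = L w.

(* Climbing from v >= r in steps of q leads, past p = m q - 1, to (v + 1) mod q. *)
Definition label v := if v < r then L (v %% (2 * q)) else L (v.+1 %% q).

Lemma label_small w : w < q -> label w = L w.
Proof.
move=> wq; rewrite /label; case: ltnP => wr; first by rewrite modn_small //; lia.
by rewrite L_wrap // wr.
Qed.

Lemma label_mod v : v < p + q -> label (v %% p) = label v.
Proof.
move=> vpq; case: (ltnP v p) => vp; first by rewrite modn_small.
have rv : (v < r) = false by lia.
have vE : v.+1 %% q = v - p.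
  have -> : v.+1 = m * q + (v - p) by lia.
  by rewrite modnMDl modn_small //; lia.
have wE : label (v - p) = L (v - p) by apply: label_small; lia.
rewrite [RHS]/label rv vE -wE; case: (ltnP (v - p) p) => vpp.
  by rewrite -{1}(subnK vp) modnDr modn_small.
(* Here [v - p] is at least [p], so [p < q]; this forces [m = 1] and [p = q - 1], and [v = 2 * p]
   reduces to 0. *)
have pq : p = q.-1 /\ v - p = p.
  have m1 : m = 1.
    have m_gt0 : 0 < m by case: m p1E.
    apply/eqP; rewrite eqn_leq m_gt0 andbT -(leq_pmul2r q_gt0) -p1E; lia.
  by have := p1E; rewrite m1; lia.
have -> : v %% p = 0 by rewrite -(subnK vp) modnDr pq.2 modnn.
rewrite label_small // wE -(@L_wrap (v - p)); last by lia.
have -> : (v - p).+1 = q by lia.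
by rewrite modnn.
Qed.

Lemma label_invariant :
  (forall y, y < r -> label (B y + q) = label y) ->
  forall y, y < p -> label (h y) = label y.
Proof.
move=> LB y yp; rewrite label_mod; last first.
  by case: (ltnP y r) => yr; [have := B_lt yr; lia | rewrite B_id //; lia].
case: (ltnP y r) => yr; first exact: LB.
rewrite B_id // /label !ltnNge yr (leq_trans yr (leq_addr _ _)) /=.
by rewrite -addSn modnDr.
Qed.

End Labelling.

(* Points of [p, 2p) also stand for residues, so that the wrap-around of
   the rotation by q needs no case distinction. *)
Definition same_orbit x y := orbit_eq p h (x %% p) (y %% p).

Lemma same_orbit_refl x : same_orbit x x.
Proof. exact: rst_refl. Qed.

Lemma same_orbit_trans y x z : same_orbit x y -> same_orbit y z -> same_orbit x z.
Proof. exact: rst_trans. Qed.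

Lemma same_orbit_sym x y : same_orbit x y -> same_orbit y x.
Proof. exact: rst_sym. Qed.

Lemma same_orbit_step y : y < p -> same_orbit y (B y + q).
Proof.
by move=> yp; apply: rst_step; rewrite (modn_small yp).
Qed.

(** Adding [q] repeatedly reaches [[p, p + q)], where subtracting [p = m * q - 1] amounts to taking
    the successor modulo [q]. *)
Lemma same_orbit_wrap v : r <= v < p + q -> same_orbit v (v.+1 %% q).
Proof.
have [k] := ubnP (p + q - v); elim: k v => // k IH v kv /andP[rv vpq].
case: (ltnP v p) => vp.
  have {}IH : same_orbit (v + q) ((v + q).+1 %% q) by apply: IH; lia.
  rewrite -addSn modnDr in IH; apply: same_orbit_trans IH.
  by have := same_orbit_step vp; rewrite B_id.
have -> : v.+1 = m * q + (v - p) by lia.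
rewrite modnMDl modn_small; last by lia.
by rewrite /same_orbit -{1}(subnK vp) modnDr; apply: rst_refl.
Qed.

(** A position [y >= r] shares orbit and label with [y.+1 %% q], so invariance needs checking only
    below [r], and connectivity only below [r] or [q]. *)
Lemma has_orbits_of_label (L : nat -> nat) (g : nat) (rep : nat -> nat) :
  (forall w, r <= w < q -> L (w.+1 %% q) = L w) ->
  (forall w, L w < g) ->
  (forall y, y < r -> label L (B y + q) = label L y) ->
  (forall c, c < g -> rep c < p /\ label L (rep c) = c) ->
  (forall y, (y < r) || (y < q) -> same_orbit y (rep (label L y))) ->
  has_orbits p h g.
Proof.
move=> Lw Lg LB repP conn; exists (label L), rep; split=> // y yp.
  by split; [rewrite /label; case: ifP | exact: label_invariant].
have Lyg : label L y < g by rewrite /label; case: ifP.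
have -> : orbit_eq p h y (rep (label L y)) = same_orbit y (rep (label L y)).
  by rewrite /same_orbit !modn_small // (repP _ _).1.
case: (ltnP y r) => yr; first by apply: conn; rewrite yr.
apply: (@same_orbit_trans (y.+1 %% q)); first by apply: same_orbit_wrap; lia.
have wq : y.+1 %% q < q by rewrite ltn_pmod.
have -> : label L y = label L (y.+1 %% q).
  by rewrite [RHS]label_small // /label ltnNge yr.
by apply: conn; rewrite wq orbT.
Qed.

End TwoRotations.

(** Since [r <= q], the image [B y + q] of [y < r] lies above [r] and climbs to [(B y).+1] modulo
    [q]; if that is [r], it drifts on in single steps to 0. The return to [[0, r)] is thus
    translation by [s + 1] modulo [r]. *)
Lemma short_rotation_orbits (p q r m s : nat) (B : nat -> nat) :
  0 < r -> r <= p -> p.+1 = m * q -> r <= q ->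
  (forall y, B y = if y < r then (y + s) %% r else y) ->
  has_orbits p (fun y => (B y + q) %% p) (gcdn r s.+1).
Proof.
move=> r0 rp p1E rq BE; have q0 : 0 < q by exact: leq_trans rq.
set g := gcdn r s.+1; have g0 : 0 < g by rewrite gcdn_gt0 r0.
have gr : g <= r by apply: dvdn_leq; rewrite ?dvdn_gcdl.
have /dvdnP[a ra] : g %| r by exact: dvdn_gcdl.
have B_lt y : y < r -> B y < r by move=> yr; rewrite BE yr ltn_pmod.
have B_id y : r <= y -> B y = y by move=> yr; rewrite BE ltnNge yr.
(* Positions in [[r, q)] drift up to 0, so they take its label; as [g] divides [r], this agrees with
   [r %% g] at [r]. *)
pose L w := if w < r then w %% g else 0.
have L_le w : w <= r -> L w = w %% g.
  by rewrite leq_eqVlt /L => /orP[/eqP->|->//]; rewrite ltnn ra modnMl.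
have L_lt w : L w < g by rewrite /L; case: ifP => //; rewrite ltn_pmod.
have LW w : w < q -> L (w.+1 %% q) = L w.+1.
  rewrite leq_eqVlt => /orP[/eqP wq|wq]; last by rewrite modn_small.
  by rewrite wq modnn /L r0 mod0n; case: ifP => // qr; have := rq; lia.
have L_wrap w : r <= w < q -> L (w.+1 %% q) = L w.
  by move=> /andP[rw wq]; rewrite LW // /L !ltnNge rw (leq_trans rw) //.
have label_r w : w < r -> label q r L w = w %% g.
  move=> wr; rewrite /label wr modn_small; last by lia.
  by rewrite L_le // ltnW.
have LB y : y < r -> L ((B y).+1) = y %% g.
  move=> yr; rewrite BE yr L_le ?ltn_pmod //.
  rewrite -addn1 -modnDml modn_dvdm ?dvdn_gcdl // modnDml -addnA addn1.
  have /dvdnP[b sb] : g %| s.+1 by exact: dvdn_gcdr.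
  by rewrite sb addnC modnMDl.
apply: (@has_orbits_of_label p q r m B _ _ _ _ _ _ L _ id) => //.
- move=> y yr; rewrite (label_r y) // -LB // /label ltnNge.
  rewrite (leq_trans rq (leq_addl _ _)) /= -addSn modnDr LW //.
  exact: leq_trans (B_lt _ yr) rq.
- move=> c cg; rewrite label_r ?modn_small //; first by split=> //; lia.
  exact: leq_trans cg gr.
set E := same_orbit _ _ _.
have Et y x z : E x y -> E y z -> E x z by exact: same_orbit_trans.
have E0 w : r <= w < q -> E w 0.
  have [k] := ubnP (q - w); elim: k w => // k IH w kw /andP[rw wq].
  apply: (Et (w.+1 %% q)); first by apply: (@same_orbit_wrap p q r m) => //; lia.
  move: wq; rewrite leq_eqVlt => /orP[/eqP->|wq]; last first.
    by rewrite modn_small //; apply: IH; lia.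
  by rewrite modnn; apply: same_orbit_refl.
have Es y : y < r -> E y ((y + s.+1) %% r).
  move=> yr; apply: (Et (B y + q)).
    by apply: same_orbit_step => //; lia.
  apply: (Et ((B y).+1 %% q)).
    rewrite -(modnDr (B y).+1 q) addSn; apply: (@same_orbit_wrap p q r m) => //.
    by have := B_lt _ yr; lia.
  have -> : (y + s.+1) %% r = (B y).+1 %% r.
    by rewrite BE yr addnS -[in RHS]addn1 modnDml addn1.
  have := B_lt _ yr; rewrite leq_eqVlt => /orP[/eqP->|lt]; last first.
    by rewrite !modn_small //; [exact: same_orbit_refl|lia].
  rewrite modnn; move: rq; rewrite leq_eqVlt => /orP[/eqP->|rq'].
    by rewrite modnn; exact: same_orbit_refl.
  by rewrite modn_small //; apply: E0; rewrite leqnn.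
have Eg y : y < r -> E y (y %% g).
  apply: translation_orbits => //; first by move=> x; exact: same_orbit_refl.
  by move=> x y' z; exact: Et.
move=> y; case: (ltnP y r) => yr /= yq; first by rewrite label_r //; exact: Eg.
rewrite (@label_small p q r m) //.
by rewrite /L ltnNge yr /=; apply: E0; rewrite yr.
Qed.

(** * Orbits when the first [r > q] positions are rotated by [q] *)

Section LongRotation.

Variables (p q r m : nat) (B : nat -> nat).
Hypotheses (q_gt0 : 0 < q) (lt_qr : q < r) (le_rp : r <= p) (p1E : p.+1 = m * q).
Hypothesis BE : forall y, B y = if y < r then (y + q) %% r else y.

Let r_gt0 : 0 < r. Proof. exact: leq_trans lt_qr. Qed.

Let B_lt y : y < r -> B y < r.
Proof. by move=> yr; rewrite BE yr ltn_pmod. Qed.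

Let B_id y : r <= y -> B y = y.
Proof. by move=> yr; rewrite BE ltnNge yr. Qed.

Lemma long_rotation_low y : y + q < r -> B y + q = y + 2 * q.
Proof. by move=> yq; rewrite BE ifT ?modn_small //; lia. Qed.

(** The window [[r - q, r)] is rotated onto [[0, q)], then lifted by [q]. *)
Lemma long_rotation_high u : u < q -> B (r - q + u) + q = u + q.
Proof.
move=> uq; rewrite BE ifT; last by lia.
by rewrite addnAC subnK ?modnDl ?modn_small //; lia.
Qed.

Local Notation E := (same_orbit p q B).

Let Et y x z : E x y -> E y z -> E x z. Proof. exact: same_orbit_trans. Qed.

(** A step requires only its starting point to be below [r - q], so the last one may land anywhere
    below [r + q]. *)
Lemma same_orbit_low b j : b + 2 * q * j < r + q -> E b (b + 2 * q * j).
Proof.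
elim: j => [|j IH] bj; first by rewrite muln0 addn0; exact: same_orbit_refl.
have bq : b + 2 * q * j + q < r by lia.
apply: Et (IH _) _; first by lia.
have -> : b + 2 * q * j.+1 = (b + 2 * q * j) + 2 * q by lia.
by rewrite -long_rotation_low //; apply: same_orbit_step; lia.
Qed.

Lemma same_orbit_mod y : y < r -> E y (y %% (2 * q)).
Proof.
move=> yr; apply: same_orbit_sym.
have yE : y = y %% (2 * q) + 2 * q * (y %/ (2 * q)).
  by rewrite addnC [2 * q * _]mulnC -divn_eq.
by rewrite {2}yE; apply: same_orbit_low; rewrite -yE; lia.
Qed.

Lemma same_orbit_high u : u < q -> E (r - q + u) (u + q).
Proof.
by move=> uq; rewrite -(long_rotation_high uq); apply: same_orbit_step; lia.
Qed.

(** The climb skips the window [[r - q, r)] and leaves [[0, r)]; the multiple of [2 * q] then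
    disappears modulo [q]. *)
Lemma same_orbit_exit c j :
  r <= c + 2 * q * j < r + q -> E c (c.+1 %% q).
Proof.
move=> /andP[rc cr]; apply: Et (same_orbit_low cr) _.
have -> : c.+1 %% q = (c + 2 * q * j).+1 %% q.
  have -> : (c + 2 * q * j).+1 = 2 * j * q + c.+1 by lia.
  by rewrite modnMDl.
by apply: (@same_orbit_wrap p q r m) => //; rewrite rc; lia.
Qed.

(** Residues modulo [2 * q] in [[rho, rho + q)] exit; the others hit the window. From [c < rho] the
    window leads to [c + 2 * q - rho], descents by [rho] lead to [[q, q + rho)], and the exit
    subtracts [q - 1]: altogether translation by [q + 1] modulo [rho]. *)
Lemma long_rotation_orbits_le k rho :
  r = 2 * q * k + rho -> 0 < k -> 0 < rho -> rho <= q ->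
  has_orbits p (fun y => (B y + q) %% p) (gcdn rho q.+1).
Proof.
move=> rE k0 rho0 rhoq.
have qk : 2 * q * k = 2 * q + 2 * q * k.-1 by rewrite -mulnS prednK.
have qk_ge : 2 * q <= 2 * q * k by rewrite qk leq_addr.
set g := gcdn rho q.+1; have g0 : 0 < g by rewrite gcdn_gt0 rho0.
have grho : g <= rho by apply: dvdn_leq; rewrite ?dvdn_gcdl.
have /dvdnP[a rhoa] : g %| rho by exact: dvdn_gcdl.
have /dvdnP[b qb] : g %| q.+1 by exact: dvdn_gcdr.
(* The orbit of c in [0, 2q) first meets [0, rho) at 0 if rho <= c < q, and at
   c + 1 - q modulo rho if c >= q; modulo g the latter is c + 2. *)
pose L c := (if c < rho then c else if c < q then 0 else c + 2) %% g.
have L_lt w : L w < g by rewrite /L ltn_pmod.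
have L_small c : c < rho -> L c = c %% g by move=> cr; rewrite /L cr.
have L_mid c : rho <= c <= q -> L (c %% q) = 0.
  case/andP=> rc; rewrite leq_eqVlt => /orP[/eqP->|cq].
    by rewrite modnn L_small // mod0n.
  by rewrite modn_small // /L ltnNge rc cq mod0n.
have L_big c : q <= c -> L c = (c + 2) %% g.
  by move=> qc; rewrite /L !ltnNge qc (leq_trans rhoq qc).
have LW c : rho <= c < rho + q -> L (c.+1 %% q) = L c.
  move=> /andP[rc cr]; case: (ltnP c q) => cq.
    by rewrite L_mid ?(leq_trans rc) // -[c in RHS](modn_small cq) L_mid // rc ltnW.
  rewrite (L_big c) // -{1}(subnK (leqW cq)) modnDr.
  have : c.+1 - q <= rho by lia.
  rewrite leq_eqVlt => /orP[/eqP cE|clt].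
    rewrite cE L_mid ?leqnn //; apply/esym/eqP; rewrite -/(dvdn _ _).
    have -> : c + 2 = (a + b) * g by rewrite mulnDl; lia.
    by rewrite dvdn_mull.
  rewrite modn_small ?L_small //; last by lia.
  by apply: (@eqmod_shift _ _ _ b 0); lia.
have E0 c : rho <= c < q -> E c 0.
  have [n] := ubnP (q - c); elim: n c => // n IH c nc /andP[rc cq].
  apply: (Et (y := c.+1 %% q)); first by apply: (@same_orbit_exit _ k); lia.
  move: cq; rewrite leq_eqVlt => /orP[/eqP->|cq].
    by rewrite modnn; exact: same_orbit_refl.
  by rewrite modn_small //; apply: IH; lia.
have E_big c : q <= c < 2 * q -> E c ((c.+1 - q) %% rho).
  elim/ltn_ind: c => c IH /andP[qc cq]; case: (ltnP c (q + rho)) => cr.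
    apply: (Et (y := c.+1 %% q)); first by apply: (@same_orbit_exit _ k); lia.
    rewrite -{1}(subnK (leqW qc)) modnDr.
    have : c.+1 - q <= rho by lia.
    rewrite leq_eqVlt => /orP[/eqP->|clt]; last first.
      by rewrite !modn_small //; [exact: same_orbit_refl|lia].
    rewrite modnn; move: rhoq; rewrite leq_eqVlt => /orP[/eqP->|rhoq'].
      by rewrite modnn; exact: same_orbit_refl.
    by rewrite modn_small //; apply: E0; rewrite leqnn.
  (* From [q + rho] on, a climb of [k - 1] turns ends in the window and comes back at [c - rho]. *)
  have -> : c.+1 - q = (c - rho).+1 - q + rho by lia.
  rewrite modnDr; apply: (Et (y := c - rho)); last by apply: IH; lia.
  apply: (Et (same_orbit_low (j := k.-1) _)); first by lia.
  have -> : c + 2 * q * k.-1 = r - q + (c - rho - q) by lia.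
  rewrite -{2}(@subnK q (c - rho)); last by lia.
  by apply: same_orbit_high; lia.
have Es c : c < rho -> E c ((c + q.+1) %% rho).
  move=> cr; apply: (Et (same_orbit_low (j := k) _)); first by lia.
  have -> : c + 2 * q * k = r - q + (c + q - rho) by lia.
  apply: (Et (same_orbit_high _)); first by lia.
  have -> : (c + q.+1) %% rho = ((c + q - rho + q).+1 - q) %% rho.
    by apply: (@eqmod_shift _ _ _ 0 1); lia.
  by apply: E_big; lia.
have Eg c : c < rho -> E c (c %% g).
  apply: translation_orbits => //; first by move=> x; exact: same_orbit_refl.
  by move=> x y z; exact: Et.
have EL c : c < 2 * q -> E c (L c).
  move=> c2q; case: (ltnP c rho) => cr; first by rewrite L_small //; exact: Eg.
  case: (ltnP c q) => cq.
    by rewrite -{2}(modn_small cq) L_mid ?cr ?(ltnW cq) //; apply: E0; rewrite cr.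
  apply: (Et (E_big _ _)); first by rewrite cq.
  apply: (Et (Eg _ _)); first by rewrite ltn_pmod.
  rewrite modn_dvdm ?dvdn_gcdl // L_big //.
  have -> : (c + 2) %% g = (c.+1 - q) %% g by apply: (@eqmod_shift _ _ _ 0 b); lia.
  exact: same_orbit_refl.
have label_low y : y < r -> label q r L y = L (y %% (2 * q)).
  by rewrite /label => ->.
apply: (@has_orbits_of_label p q r m B _ _ _ _ _ _ L _ id) => //.
- by move=> w; lia.
- move=> y yr; rewrite (label_low y) //; case: (ltnP (y + q) r) => yq.
    rewrite long_rotation_low //; case: (ltnP (y + 2 * q) r) => y2.
      by rewrite label_low // modnDr.
    rewrite /label ltnNge y2 /=.
    set c := y + 2 * q - 2 * q * k.
    have -> : y = k.-1 * (2 * q) + c by lia.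
    rewrite modnMDl (modn_small (_ : c < _)); last by lia.
    have -> : (k.-1 * (2 * q) + c + 2 * q).+1 = (2 * k) * q + c.+1 by lia.
    by rewrite modnMDl LW //; lia.
  have -> : y = r - q + (y + q - r) by lia.
  rewrite long_rotation_high; last by lia.
  rewrite label_low; last by lia.
  rewrite modn_small; last by lia.
  rewrite L_big; last by lia.
  set u := y + q - r.
  (* The residue of this position is [rho + q + u], less [2 * q] if needed; the labels agree since
     [g] divides [rho] and [q + 1]. *)
  have -> : r - q + u = k.-1 * (2 * q) + (rho + q + u) by lia.
  rewrite modnMDl; case: (ltnP (rho + q + u) (2 * q)) => uq.
    rewrite (modn_small uq) L_big; last by lia.
    by apply: (@eqmod_shift _ _ _ a 0); lia.
  rewrite -(subnK uq) modnDr (@modn_small _ (2 * q)); last by lia.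
  rewrite L_small; last by lia.
  by apply: (@eqmod_shift _ _ _ a (2 * b)); lia.
- move=> c cg; have cr : c < rho by exact: leq_trans grho.
  rewrite label_low; last by lia.
  by rewrite modn_small ?L_small ?modn_small //; lia.
- move=> y yr; rewrite label_low; last by lia.
  apply: (Et (same_orbit_mod _)); first by lia.
  by apply: EL; rewrite ltn_pmod // muln_gt0.
Qed.

(** Put [d = 2 * q - rho] and [e = rho - q]. Residues in [[e, rho)] hit the window and rise by [d];
    those below [e] exit and grow by 1 up to [e]. From [e + u] the rises end in [[rho, 2 * q)],
    whose exit subtracts [q - 1]; the return to [[e, q)] is translation by [q + 1 - rho], which is
    [1 - q] modulo [d]. *)
Lemma long_rotation_orbits_gt k rho :
  r = 2 * q * k + rho -> q < rho < 2 * q ->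
  has_orbits p (fun y => (B y + q) %% p) (gcdn (2 * q - rho) q.-1).
Proof.
move=> rE /andP[qrho rho2q].
pose d := 2 * q - rho; pose e := rho - q; have d0 : 0 < d by lia.
have dq : q <= d * q by rewrite leq_pmull.
set g := gcdn d q.-1; have g0 : 0 < g by rewrite gcdn_gt0 d0.
have gd : g <= d by apply: dvdn_leq; rewrite ?dvdn_gcdl.
have /dvdnP[a da] : g %| d by exact: dvdn_gcdl.
have /dvdnP[b qb] : g %| q.-1 by exact: dvdn_gcdr.
(* Orbits first meet [e, e + d) = [e, q) at e if c < e, and at e + (c + 1 - rho) mod d
   if c >= q; modulo g, c - e and c + 1 - rho are both c - 1. *)
pose L c := if c < e then 0 else c.-1 %% g.
have L_lt w : L w < g by rewrite /L; case: ifP => //; rewrite ltn_pmod.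
have L_ge c : e <= c -> L c = c.-1 %% g by move=> ec; rewrite /L ltnNge ec.
have L_le c : c <= e -> L c = 0.
  rewrite leq_eqVlt /L => /orP[/eqP->|->//]; rewrite ltnn; apply/eqP.
  (* [e - 1] is the difference of [q - 1] and [d], both multiples of [g], so the two clauses of [L]
     match at [e]. *)
  rewrite -/(dvdn _ _); have -> : e.-1 = (b - a) * g by rewrite mulnBl; lia.
  by rewrite dvdn_mull.
have LW c : c < e \/ rho <= c < 2 * q -> L (c.+1 %% q) = L c.
  case=> [ce|/andP[rc cq]].
    by rewrite modn_small ?L_le //; lia.
  rewrite -{1}(@subnK q c.+1) ?modnDr; last by lia.
  move: cq; rewrite leq_eqVlt => /orP[/eqP cq|cq].
    (* From [2 * q - 1] the exit reaches 0; the label vanishes since [g] divides [2 * (q - 1)]. *)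
    have -> : c.+1 - q = q by lia.
    rewrite modnn L_le // L_ge; last by lia.
    apply/esym/eqP; rewrite -/(dvdn _ _).
    have -> : c.-1 = 2 * b * g by lia.
    by rewrite dvdn_mull.
  rewrite modn_small; last by lia.
  rewrite !L_ge; try lia.
  by apply: (@eqmod_shift _ _ _ b 0); lia.
have Ee c : c <= e -> E c e.
  have [n] := ubnP (e - c); elim: n c => // n IH c nc.
  rewrite leq_eqVlt => /orP[/eqP->|ce]; first exact: same_orbit_refl.
  apply: (Et (y := c.+1 %% q)); first by apply: (@same_orbit_exit _ k.+1); lia.
  by rewrite modn_small; last lia; apply: IH; lia.
(* The summand [d * q] vanishes modulo [d] and keeps the subtraction from truncating. *)
have E_big c : q <= c < 2 * q -> E c (e + (c.+1 + d * q - rho) %% d).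
  have [n] := ubnP (2 * q - c); elim: n c => // n IH c nc /andP[qc cq].
  case: (ltnP c rho) => cr.
    apply: (Et (y := c + d)).
      apply: (Et (same_orbit_low (j := k) _)); first by lia.
      have -> : c + 2 * q * k = r - q + (c - e) by lia.
      have -> : c + d = c - e + q by lia.
      by apply: same_orbit_high; lia.
    have -> : (c.+1 + d * q - rho) %% d = ((c + d).+1 + d * q - rho) %% d.
      by apply: (@eqmod_shift _ _ _ 1 0); lia.
    by apply: IH; lia.
  apply: (Et (y := c.+1 %% q)); first by apply: (@same_orbit_exit _ k); lia.
  have -> : c.+1 + d * q - rho = q * d + (c.+1 - rho) by lia.
  rewrite modnMDl -{1}(@subnK q c.+1) ?modnDr; last by lia.
  have : c.+1 - rho <= d by lia.
  rewrite leq_eqVlt => /orP[/eqP cE|clt].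
    have -> : c.+1 - q = q by lia.
    by rewrite cE !modnn addn0; apply: Ee.
  rewrite !modn_small //; try lia.
  have -> : c.+1 - q = e + (c.+1 - rho) by lia.
  exact: same_orbit_refl.
pose t := q.+1 + d * q - rho.
have Es u : u < d -> E (e + u) (e + (u + t) %% d).
  move=> ud; apply: (Et (same_orbit_low (j := k) _)); first by lia.
  have -> : e + u + 2 * q * k = r - q + u by lia.
  apply: (Et (same_orbit_high _)); first by lia.
  have -> : u + t = (u + q).+1 + d * q - rho by rewrite /t; lia.
  by apply: E_big; lia.
(* [t + (q - 1)] equals [(q + 1) * d]. *)
have gE : gcdn d t = g.
  by apply: (@gcdn_complement _ _ q.+1); rewrite /t; lia.
have Eg u : u < d -> E (e + u) (e + u %% g).
  rewrite -gE; apply: (@translation_orbits (fun x y => E (e + x) (e + y))) => //.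
    by move=> x; exact: same_orbit_refl.
  by move=> x y z; exact: Et.
have EL c : c < 2 * q -> E c (e + L c).
  move=> c2q; case: (leqP c e) => ce; first by rewrite L_le // addn0; exact: Ee.
  rewrite L_ge; last by lia.
  case: (ltnP c q) => cq.
    have -> : c.-1 %% g = (c - e) %% g by apply: (@eqmod_shift _ _ _ a b); lia.
    by rewrite -{1}(subnKC (ltnW ce)); apply: Eg; lia.
  apply: (Et (E_big _ _)); first by rewrite cq.
  apply: (Et (Eg _ _)); first by rewrite ltn_pmod.
  rewrite modn_dvdm ?dvdn_gcdl //.
  have -> : (c.+1 + d * q - rho) %% g = c.-1 %% g.
    by apply: (@eqmod_shift _ _ _ (2 * b) (a * q + a)); lia.
  exact: same_orbit_refl.
have label_low y : y < r -> label q r L y = L (y %% (2 * q)).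
  by rewrite /label => ->.
apply: (@has_orbits_of_label p q r m B _ _ _ _ _ _ L _ (addn e)) => //.
- by move=> w; lia.
- move=> y yr; rewrite (label_low y) //; case: (ltnP (y + q) r) => yq.
    rewrite long_rotation_low //; case: (ltnP (y + 2 * q) r) => y2.
      by rewrite label_low // modnDr.
    rewrite /label ltnNge y2 /=.
    set c := y + 2 * q - 2 * q * k.
    have -> : (y + 2 * q).+1 %% q = (c %% (2 * q)).+1 %% q.
      have cE := divn_eq c (2 * q).
      by apply: (@eqmod_shift _ _ _ 0 (2 * k + 2 * (c %/ (2 * q)))); lia.
    have -> : y %% (2 * q) = c %% (2 * q) by apply: (@eqmod_shift _ _ _ 1 k); lia.
    (* [c] ranges over [[rho, rho + q)], which extends past [2 * q]; there its residue falls below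
       [e], the other kind of exit. *)
    apply: LW; case: (ltnP c (2 * q)) => cq.
      by right; rewrite modn_small //; lia.
    by left; rewrite -(subnK cq) modnDr modn_small; lia.
  have -> : y = r - q + (y + q - r) by lia.
  rewrite long_rotation_high; last by lia.
  set u := y + q - r.
  have -> : r - q + u = k * (2 * q) + (e + u) by lia.
  rewrite modnMDl [in RHS]modn_small; last by lia.
  have -> : L (e + u) = L (u + q).
    by rewrite !L_ge; try lia; apply: (@eqmod_shift _ _ _ (a + b) b); lia.
  (* When [k = 0] the image [u + q] may already be at least [r]; its label is then read after its
     exit. *)
  rewrite /label; case: ltnP => ur; first by rewrite modn_small //; lia.
  by apply: LW; right; lia.
- move=> c cg; rewrite label_low; last by lia.
  rewrite modn_small; last by lia.
  rewrite L_ge; last by lia.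
  split; first by lia.
  rewrite -[RHS](modn_small cg); apply: (@eqmod_shift _ _ _ a b); lia.
- move=> y yr; rewrite label_low; last by lia.
  apply: (Et (same_orbit_mod _)); first by lia.
  by apply: EL; rewrite ltn_pmod // muln_gt0.
Qed.

End LongRotation.

(** * Components of closed braids *)

Local Open Scope classical_set_scope.
Local Open Scope ring_scope.

(** Each [K c] and the finite union of the other pieces are closed and disjoint, hence separated, so
    a connected set that meets [K c] cannot leave it. *)
Lemma card_components_closed_partition (T : topologicalType) (L : set T)
    (K : nat -> set T) (g : nat) :
  L = \bigcup_(c in `I_g) K c ->
  (forall c, (c < g)%N -> [/\ closed (K c), connected (K c) & K c !=set0]) ->
  (forall b c x, (b < g)%N -> (c < g)%N -> K b x -> K c x -> b = c) ->
  #|` fset_set [set connected_component L x | x in L]|%fset = g.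
Proof.
move=> LE KP Kdisj.
have compE c x : (c < g)%N -> K c x -> connected_component L x = K c.
  move=> cg Kx; have [Kcl Kco _] := KP c cg.
  have KL : K c `<=` L by move=> y Ky; rewrite LE; exists c.
  apply/seteqP; split; last exact: connected_component_max.
  pose K' := \bigcup_(b in [set b | (b < g)%N /\ b <> c]) K b.
  have K'cl : closed K'.
    apply: closed_bigcup; last by move=> b [bg _]; have [] := KP b bg.
    by apply: (sub_finite_set _ (finite_II g)) => b [].
  have KK' : K c `&` K' = set0.
    apply/seteqP; split=> // y [Ky [b [bg bc] Kby]].
    by apply: bc; exact: Kdisj Kby Ky.
  have sep : separated (K c) K'.
    by split; rewrite -(iffLR (closure_id _)).
  have cover : connected_component L x `<=` K c `|` K'.
    move=> y /connected_component_sub; rewrite LE => -[b bg Kby].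
    have [<-|bc] := pselect (b = c); first by left.
    by right; exists b.
  have [//|sub] := connected_subset sep cover (@component_connected _ _ _).
  have : (K c `&` K') x.
    split=> //; apply: sub; apply: connected_component_refl; exact: KL.
  by rewrite KK'.
have -> : [set connected_component L x | x in L] = K @` `I_g.
  apply/seteqP; split=> A.
    move=> [x Lx <-]; have := Lx; rewrite {1}LE => -[c cg Kx].
    by exists c => //; rewrite (compE c).
  move=> [c cg <-]; have [_ _ [x Kx]] := KP c cg.
  by exists x; [rewrite LE; exists c | exact: compE].
apply: card_fset_set; apply: inj_card_eq => b c.
rewrite !inE => /= bg cg Kbc; have [_ _ [x Kx]] := KP b bg.
by apply: (Kdisj b c x) => //; rewrite -Kbc.
Qed.

(** * Geometry of segments, strands and closing arcs *)

Section Pieces.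

Variable R : realType.
Implicit Types P Q M : 'rV[R]_3.

Lemma segment3_continuous P Q :
  continuous (fun t : R => (1 - t) *: P + t *: Q).
Proof.
move=> t; apply: cvgD; apply: cvgZ; [|exact: cvg_cst|exact: cvg_id|exact: cvg_cst].
by apply: cvgB; [exact: cvg_cst|exact: cvg_id].
Qed.

Lemma segment3_connected P Q : connected (segment3 P Q).
Proof.
apply: connected_continuous_connected; first exact: segment_connected.
by apply: continuous_subspaceT; exact: segment3_continuous.
Qed.

Lemma segment3_closed P Q : closed (segment3 P Q).
Proof.
apply: compact_closed; first exact: norm_hausdorff.
apply: continuous_compact; last exact: segment_compact.
by apply: continuous_subspaceT; exact: segment3_continuous.
Qed.

Lemma segment3_left P Q : segment3 P Q P.
Proof.
by exists 0; rewrite /= ?in_itv /= ?lexx ?ler01 // subr0 scale1r scale0r addr0.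
Qed.

Lemma segment3_right P Q : segment3 P Q Q.
Proof.
by exists 1; rewrite /= ?in_itv /= ?lexx ?ler01 // subrr scale0r scale1r add0r.
Qed.

Lemma polyline_head P s : polyline P s P.
Proof. by case: s => //= Q s; left; exact: segment3_left. Qed.

Lemma polyline_last P s : polyline P s (last P s).
Proof. by elim: s P => [|Q s IH] P //=; right; exact: IH. Qed.

Lemma polyline_connected P s : connected (polyline P s).
Proof.
elim: s P => [|Q s IH] P /=; first exact: connected1.
apply: connectedU; [|exact: segment3_connected|exact: IH].
by exists Q; split; [exact: segment3_right|exact: polyline_head].
Qed.

Lemma polyline_closed P s : closed (polyline P s).
Proof.
elim: s P => [|Q s IH] P /=.
  by apply: compact_closed; [exact: norm_hausdorff|exact: compact_set1].
by apply: closedU; [exact: segment3_closed|exact: IH].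
Qed.


Local Notation X M := (M ord0 (@Ordinal 3 0 isT)).
Local Notation Y M := (M ord0 (@Ordinal 3 1 isT)).
Local Notation Z M := (M ord0 (@Ordinal 3 2 isT)).

Lemma segment3_coord P Q M : segment3 P Q M ->
  exists2 t : R, 0 <= t <= 1 & forall i j, M i j = (1 - t) * P i j + t * Q i j.
Proof.
case=> t; rewrite /= in_itv /= => t01 <-; exists t => // i j.
by rewrite !mxE.
Qed.

Definition letter_act (l : nat * bool) (j : nat) : nat :=
  if j == l.1 then l.1.+1 else if j == l.1.+1 then l.1 else j.

Lemma letter_actK l : involutive (letter_act l).
Proof.
case: l => i b j; rewrite /letter_act /=.
case: (eqVneq j i) => [->|ji]; first by rewrite eqxx; case: eqP => //; lia.
case: (eqVneq j i.+1) => [->|jSi]; first by rewrite eqxx.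
by rewrite (negPf ji) (negPf jSi).
Qed.

Definition word_act (w : braid_word) (j : nat) : nat :=
  foldl (fun j l => letter_act l j) j w.

Lemma strand_polyline k l j : exists s,
  @strand R k l j = polyline (pt3 j%:R 0 k%:R) s /\
  last (pt3 j%:R 0 k%:R) s = pt3 (letter_act l j)%:R 0 k.+1%:R.
Proof.
case: l => i b; rewrite /strand /letter_act -[(i, b).1]/i.
have [->|_] := eqVneq j i; first by eexists; split; reflexivity.
by have [->|_] := eqVneq j i.+1; eexists; split; reflexivity.
Qed.

Lemma strand_bot k l j : @strand R k l j (pt3 j%:R 0 k%:R).
Proof. by have [s [-> _]] := strand_polyline k l j; exact: polyline_head. Qed.

Lemma strand_top k l j : @strand R k l j (pt3 (letter_act l j)%:R 0 k.+1%:R).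
Proof. by have [s [-> <-]] := strand_polyline k l j; exact: polyline_last. Qed.

Lemma strand_connected k l j : connected (@strand R k l j).
Proof. by have [s [-> _]] := strand_polyline k l j; exact: polyline_connected. Qed.

Lemma strand_closed k l j : closed (@strand R k l j).
Proof. by have [s [-> _]] := strand_polyline k l j; exact: polyline_closed. Qed.

(* The y-coordinate of the strand half-way up. *)
Definition strand_mid (l : nat * bool) (j : nat) : R :=
  let e := if l.2 then 1 else -1 in
  if j == l.1 then e else if j == l.1.+1 then - e else 0.

(** The bend at a crossing is half-way in both x and z, so height parametrises the strand with x
    affine. Depth is recorded only half-way up, where the two crossing strands have the same x. *)
Lemma strand_param k l j M : @strand R k l j M ->
  exists2 t : R, 0 <= t <= 1 &
    [/\ X M = (1 - t) * j%:R + t * (letter_act l j)%:R, Z M = k%:R + t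
      & t = 2^-1 -> Y M = strand_mid l j].
Proof.
have kS : k.+1%:R = k%:R + 1 :> R by rewrite -natr1.
case: l => i b; rewrite /strand /letter_act /strand_mid /=.
set e : R := if b then 1 else -1.
have iS : i.+1%:R = i%:R + 1 :> R by rewrite -natr1.
have [->|_] := eqVneq j i; last have [->|_] := eqVneq j i.+1.
- case=> [|[]] => [/segment3_coord[t t01 E]|/segment3_coord[t t01 E]|->].
  (* The two segments cover the lower and upper halves, hence the rescaled parameters; the last case
     is the singleton that ends [polyline]. *)
  + exists (t / 2); rewrite ?E /pt3 ?mxE /= ?iS ?kS; first by lra.
    by split; [lra|lra|move=> th; have -> : t = 1 by lra]; lra.
  + exists ((1 + t) / 2); rewrite ?E /pt3 ?mxE /= ?iS ?kS; first by lra.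
    by split; [lra|lra|move=> th; have -> : t = 0 by lra]; lra.
  + exists 1; rewrite /pt3 ?mxE /= ?iS ?kS; first by lra.
    by split; lra.
- case=> [|[]] => [/segment3_coord[t t01 E]|/segment3_coord[t t01 E]|->].
  + exists (t / 2); rewrite ?E /pt3 ?mxE /= ?iS ?kS; first by lra.
    by split; [lra|lra|move=> th; have -> : t = 1 by lra]; lra.
  + exists ((1 + t) / 2); rewrite ?E /pt3 ?mxE /= ?iS ?kS; first by lra.
    by split; [lra|lra|move=> th; have -> : t = 0 by lra]; lra.
  + exists 1; rewrite /pt3 ?mxE /= ?iS ?kS; first by lra.
    by split; lra.
- case=> [/segment3_coord[t t01 E]|->].
  + exists t; rewrite ?E /pt3 ?mxE /= ?kS; first by lra.
    by split; lra.
  + exists 1; rewrite /pt3 ?mxE /= ?kS; first by lra.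
    by split; lra.
Qed.

Lemma letter_act_inj l : injective (letter_act l).
Proof. exact: (inv_inj (@letter_actK l)). Qed.

Lemma ltr_nat1 (i j : nat) : (i < j)%N -> i%:R + 1 <= j%:R :> R.
Proof. by rewrite natr1 ler_nat. Qed.

(** A common point has the same height on both strands. Crossing strands have equal x only half-way
    up, where y is 1 on one and -1 on the other; the remaining strands are vertical, at distance at
    least 1 from the crossing columns. *)
Lemma strand_inj k l i j M : @strand R k l i M -> @strand R k l j M -> i = j.
Proof.
move=> /strand_param[t t01 [Xi Zi Yi]] /strand_param[t' _ [Xj Zj Yj]].
have tt : t' = t by move: Zj; rewrite Zi; lra.
move: Xj Yj Yi; rewrite tt Xi {Xi Zi Zj tt t'} /letter_act /strand_mid.
case: l => a b; rewrite -[(a, b).1]/a -[(a, b).2]/b.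
have aS : a.+1%:R = a%:R + 1 :> R by rewrite -natr1.
have far x : x <> a -> x <> a.+1 -> x%:R + 1 <= a%:R :> R \/ a%:R + 2 <= x%:R :> R.
  move=> xa xa1; have [xlt|xlt|//] := ltngtP x a; [left|right].
    exact: ltr_nat1.
  have : (a.+1 < x)%N by lia.
  by move=> /ltr_nat1; rewrite aS; lra.
have eq_natr x y : (1 - t) * x%:R + t * x%:R = (1 - t) * y%:R + t * y%:R :> R -> x = y.
  by move=> xy; apply/eqP; rewrite -(eqr_nat R); apply/eqP; lra.
case: (eqVneq i a) => [->|/eqP ia]; last case: (eqVneq i a.+1) => [->|/eqP iSa];
  case: (eqVneq j a) => [->|/eqP ja]; try (case: (eqVneq j a.+1) => [->|/eqP jSa]);
  rewrite ?aS => Xij Yj Yi //.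
- have th : t = 2^-1 by lra.
  by exfalso; move: (Yj th); rewrite (Yi th); case: b {Yj Yi} => ?; lra.
- by exfalso; have [] := far j ja jSa; nra.
- have th : t = 2^-1 by lra.
  by exfalso; move: (Yj th); rewrite (Yi th); case: b {Yj Yi} => ?; lra.
- by exfalso; have [] := far j ja jSa; nra.
- by exfalso; have [] := far i ia iSa; nra.
- by exfalso; have [] := far i ia iSa; nra.
- exact: eq_natr.
Qed.

Lemma closing_arc_connected p n j : connected (@closing_arc R p n j).
Proof. exact: polyline_connected. Qed.

Lemma closing_arc_closed p n j : closed (@closing_arc R p n j).
Proof. exact: polyline_closed. Qed.

Lemma closing_arc_top p n j : @closing_arc R p n j (pt3 j%:R 0 n%:R).
Proof. exact: polyline_head. Qed.

Lemma closing_arc_bot p n j : @closing_arc R p n j (pt3 j%:R 0 0).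
Proof. exact: polyline_last. Qed.

(** The alternatives are the inner vertical sides, the horizontal sides and the outer vertical
    side. *)
Lemma closing_arc_coord p n j M : (j <= p)%N -> @closing_arc R p n j M ->
  let h : R := p%:R + 1 - j%:R in
  (X M = j%:R /\ (n%:R <= Z M <= n%:R + h \/ - h <= Z M <= 0)) \/
  (j%:R <= X M <= p%:R + h /\ (Z M = n%:R + h \/ Z M = - h)) \/
  (X M = p%:R + h /\ - h <= Z M <= n%:R + h).
Proof.
move=> jp; rewrite /closing_arc.
have -> : (p.+1 - j)%:R = p%:R + 1 - j%:R :> R by rewrite natrB ?leqW // -natr1.
have jpR : j%:R <= p%:R :> R by rewrite ler_nat.
have n0 : 0 <= n%:R :> R by [].
move: jpR n0; set a : R := j%:R; set b : R := p%:R; set c : R := n%:R => ab c0 /=.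
have mid (x y t : R) : x <= y -> 0 <= t <= 1 ->
    x <= (1 - t) * x + t * y <= y /\ x <= (1 - t) * y + t * x <= y.
  by move=> xy /andP[t0 t1]; split; nra.
case=> [|[|[|[|[|->]]]]]; last by rewrite /pt3 !mxE /=; left; split; [|right]; lra.
- move=> /segment3_coord[t t01 E]; rewrite !E /pt3 !mxE /=.
  have [|m _] := mid c (c + (b + 1 - a)) t _ t01; first by lra.
  by left; split; [lra|left].
- move=> /segment3_coord[t t01 E]; rewrite !E /pt3 !mxE /=.
  have [|m _] := mid a (b + (b + 1 - a)) t _ t01; first by lra.
  by right; left; split; [|left; lra].
- move=> /segment3_coord[t t01 E]; rewrite !E /pt3 !mxE /=.
  have [|_ m] := mid (- (b + 1 - a)) (c + (b + 1 - a)) t _ t01; first by lra.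
  by right; right; split; [lra|].
- move=> /segment3_coord[t t01 E]; rewrite !E /pt3 !mxE /=.
  have [|_ m] := mid a (b + (b + 1 - a)) t _ t01; first by lra.
  by right; left; split; [|right; lra].
- move=> /segment3_coord[t t01 E]; rewrite !E /pt3 !mxE /=.
  have [|m _] := mid (- (b + 1 - a)) 0 t _ t01; first by lra.
  by left; split; [lra|right].
Qed.

(** For [i < j] the margin [p + 1 - i] exceeds [p + 1 - j], so the arc of [i] surrounds that of
    [j]. *)
Lemma closing_arc_inj p n i j M : (i <= p)%N -> (j <= p)%N ->
  @closing_arc R p n i M -> @closing_arc R p n j M -> i = j.
Proof.
wlog ij : i j / (i < j)%N => [wl ip jp Mi Mj|].
  by have [ij|ji|//] := ltngtP i j; [exact: wl|apply/esym/wl].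
move=> ip jp /(closing_arc_coord ip) Mi /(closing_arc_coord jp) Mj.
exfalso; move: ij => /ltr_nat1 ij.
have jpR : j%:R <= p%:R :> R by rewrite ler_nat.
have n0 : 0 <= n%:R :> R by [].
by case: Mi => [[? [?|?]]|[[? [?|?]]|[? ?]]]; case: Mj => [[? [?|?]]|[[? [?|?]]|[? ?]]]; lra.
Qed.

(** The outer side has x greater than [p], so an arc meets the box occupied by the braid only at its
    two ends. *)
Lemma closing_arc_low p n j M : (j <= p)%N -> @closing_arc R p n j M ->
  0 <= Z M <= n%:R -> X M <= p%:R -> X M = j%:R /\ (Z M = 0 \/ Z M = n%:R).
Proof.
move=> jp /(closing_arc_coord jp) Mj Zn Xp.
have jpR : j%:R <= p%:R :> R by rewrite ler_nat.
by case: Mj => [[? [?|?]]|[[? [?|?]]|[? ?]]]; lra.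
Qed.

(** * Threads and the components of a closed braid *)

Section ClosedBraid.

Variables (p : nat) (w : braid_word).
Hypothesis w_strands : all (fun l => (0 < l.1 < p)%N) w.

Let n := size w.
Let l_ k := nth (0%N, true) w k.

Definition level k j := word_act (take k w) j.

Lemma level_succ k j : (k < n)%N -> level k.+1 j = letter_act (l_ k) (level k j).
Proof.
by move=> kn; rewrite /level (take_nth (0%N, true)) // /word_act -cats1 foldl_cat.
Qed.

Lemma level_size j : level n j = word_act w j.
Proof. by rewrite /level take_size. Qed.

Lemma level_inj k : injective (level k).
Proof.
rewrite /level; elim: (take k w) => [|l v IH] i j //= /IH; exact: letter_act_inj.
Qed.

Lemma level_range k j : (0 < j <= p)%N -> (0 < level k j <= p)%N.
Proof.
have : all (fun l => (0 < l.1 < p)%N) (take k w).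
  by apply/allP => l /mem_take; exact: (allP w_strands).
rewrite /level; elim: (take k w) j => [|l v IH] j //= /andP[lp vp] jp.
by apply: IH => //; rewrite /letter_act; case: eqP => //; [lia|case: eqP; lia].
Qed.

Lemma level_onto k i : (0 < i <= p)%N -> exists2 j, (0 < j <= p)%N & level k j = i.
Proof.
have : all (fun l => (0 < l.1 < p)%N) (take k w).
  by apply/allP => l /mem_take; exact: (allP w_strands).
rewrite /level; elim: (take k w) i => [|l v IH] i /=; first by exists i.
move=> /andP[lp vp] /(IH _ vp)[j jp <-]; exists (letter_act l j).
  by rewrite /letter_act; case: eqP => //; [lia|case: eqP; lia].
by rewrite /= letter_actK.
Qed.

(** Pieces are regrouped by the position where the strand started at height 0; the arc ends at the
    base of [word_act w j], where the next thread begins. *)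
Definition thread (j : nat) : set 'rV[R]_3 :=
  closing_arc p n (level n j) `|` \bigcup_(k in `I_n) strand k (l_ k) (level k j).

Lemma closed_braid_threads :
  @closed_braid R p w = \bigcup_(j in [set j | (0 < j <= p)%N]) thread j.
Proof.
apply/seteqP; split=> M [j /= jp [Mj|[k kn Mk]]].
- by have [i ip ij] := level_onto n jp; exists i => //; left; rewrite ij.
- by have [i ip ij] := level_onto k jp; exists i => //; right; exists k; rewrite ?ij.
- by exists (level n j); [exact: level_range|left].
- by exists (level k j); [exact: level_range|right; exists k].
Qed.

Lemma thread_closed j : closed (thread j).
Proof.
apply: closedU; first exact: closing_arc_closed.
by apply: closed_bigcup; [exact: finite_II|move=> k _; exact: strand_closed].
Qed.

Lemma thread_bot j : thread j (pt3 j%:R 0 0).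
Proof.
case: (posnP n) => n0.
  by left; rewrite /level n0 take0; exact: closing_arc_bot.
right; exists 0%N => //=; rewrite /level take0.
exact: (strand_bot 0).
Qed.

(** Consecutive pieces share an endpoint. The ambient [A] is general so that threads can later be
    joined inside the union of a whole cycle. *)
Lemma thread_component (A : set 'rV[R]_3) j : thread j `<=` A ->
  thread j `<=` connected_component A (pt3 j%:R 0 0).
Proof.
move=> jA.
have join (B : set 'rV[R]_3) P : B `<=` A -> connected B -> B P ->
    connected_component A (pt3 j%:R 0 0) P ->
    B `<=` connected_component A (pt3 j%:R 0 0).
  move=> BA Bc BP jP Q BQ; apply: connected_component_trans jP _.
  exact: (connected_component_max BP).
have sA k : (k < n)%N -> strand k (l_ k) (level k j) `<=` A.
  by move=> kn M Mk; apply: jA; right; exists k.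
have up k : (k <= n)%N ->
    connected_component A (pt3 j%:R 0 0) (pt3 (level k j)%:R 0 k%:R).
  elim: k => [_|k IH kn].
    rewrite /level take0; apply: connected_component_refl; apply: jA.
    exact: thread_bot.
  apply: (join _ _ (sA k kn) _ (strand_bot k _ _) (IH (ltnW kn))).
    exact: strand_connected.
  by rewrite level_succ //; exact: strand_top.
move=> M [Mj|[k kn Mk]].
  apply: (join _ _ _ _ _ (up n (leqnn n))) Mj; last exact: closing_arc_top.
    by move=> Q Qj; apply: jA; left.
  exact: closing_arc_connected.
apply: (join _ _ (sA k kn) _ (strand_bot k _ _) (up k (ltnW kn))) Mk.
exact: strand_connected.
Qed.

Lemma strand_box k j M : (k < n)%N -> (0 < j <= p)%N -> strand k (l_ k) (level k j) M ->
  [/\ k%:R <= Z M <= k%:R + 1, X M <= p%:R,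
      Z M = k%:R -> X M = (level k j)%:R
    & Z M = k%:R + 1 -> X M = (level k.+1 j)%:R].
Proof.
move=> kn jp /strand_param[t t01 []]; rewrite -level_succ // => XM ZM _.
have /andP[_] := level_range k jp; rewrite -(ler_nat R).
have /andP[_] := level_range k.+1 jp; rewrite -(ler_nat R) => bp ap.
rewrite XM ZM; split; [lra|nra|move=> h|move=> h].
  have -> : t = 0 by lra.
  by lra.
have -> : t = 1 by lra.
by lra.
Qed.

(** Different threads can meet only at a base, where one returns and the next starts: arcs touch the
    braid box only at their ends, and strands of different layers meet only at a common end. *)
Lemma thread_disjoint i j M : (0 < i <= p)%N -> (0 < j <= p)%N ->
  thread i M -> thread j M ->
  i = j \/ i = word_act w j \/ j = word_act w i.
Proof.
move=> ip jp.
have natI (a b : nat) : a%:R = b%:R :> R -> a = b.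
  by move=> ab; apply/eqP; rewrite -(eqr_nat R) ab.
have arc_strand a b k : (0 < a <= p)%N -> (0 < b <= p)%N -> (k < n)%N ->
    closing_arc p n (level n a) M -> strand k (l_ k) (level k b) M ->
    a = b \/ b = word_act w a.
  move=> ap bp kn Ma /(strand_box kn bp)[Zk Xp Xbot Xtop].
  have /andP[_ lp] := level_range n ap.
  have k0 : 0 <= k%:R :> R by [].
  have kn1 := ltr_nat1 kn.
  have [] := closing_arc_low lp Ma _ Xp; first by lra.
  move=> XM [Z0|Zn].
    have k00 : k = 0%N by apply: natI; lra.
    right; rewrite -level_size; apply: natI; rewrite -XM Xbot; last by lra.
    by rewrite k00 /level take0.
  have kn' : k.+1 = n by apply: natI; rewrite -natr1; lra.
  left; apply: (@level_inj n); apply: natI; rewrite -XM -kn' Xtop //; lra.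
have strand_lt a b k k' : (0 < a <= p)%N -> (0 < b <= p)%N -> (k < k')%N -> (k' < n)%N ->
    strand k (l_ k) (level k a) M -> strand k' (l_ k') (level k' b) M -> a = b.
  move=> ap bp kk' kn' Ma Mb.
  have [Zk _ _ Xtop] := strand_box (ltn_trans kk' kn') ap Ma.
  have [Zk' _ Xbot _] := strand_box kn' bp Mb.
  have kk1 := ltr_nat1 kk'.
  have kE : k' = k.+1 by apply: natI; rewrite -natr1; lra.
  apply: (@level_inj k'); apply: natI; rewrite -Xbot; last by lra.
  by rewrite kE -Xtop //; lra.
move=> [Mi|[k kn Mi]] [Mj|[k' kn' Mj]].
- left; apply: (@level_inj n).
  by apply: (closing_arc_inj _ _ Mi Mj); have /andP[] := level_range n ip;
     have /andP[] := level_range n jp.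
- by have [|] := arc_strand _ _ _ ip jp kn' Mi Mj; auto.
- by have [|] := arc_strand _ _ _ jp ip kn Mj Mi; auto.
- left; have [kk|kk|kk] := ltngtP k k'.
  + exact: (strand_lt i j k k').
  + exact/esym/(strand_lt j i k' k).
  + by apply: (@level_inj k); move: Mj; rewrite -kk; exact: strand_inj.
Qed.

(** Orbits count from 0 and positions from 1, hence the shifts. Threads with one label form a closed
    set, connected because the orbit equivalence chains their bases. *)
Theorem card_components_closed_braid (g : nat) :
  has_orbits p (fun y => (word_act w y.+1).-1) g ->
  #|` fset_set (components (@closed_braid R p w))|%fset = g.
Proof.
case=> lab [rep [lab_inv repP conn]].
pose K c := \bigcup_(j in [set j | (0 < j <= p)%N /\ lab j.-1 = c]) thread j.
have wE j : (0 < j <= p)%N -> (word_act w j).-1.+1 = word_act w j.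
  by move=> /(level_range n); rewrite level_size => /andP[/prednK].
have labw j : (0 < j <= p)%N -> lab (word_act w j).-1 = lab j.-1.
  move=> jp; have [_ <-] := lab_inv j.-1 ltac:(lia).
  by have /andP[/prednK-> _] := jp.
apply: (@card_components_closed_partition _ _ K).
- rewrite closed_braid_threads; apply/seteqP; split=> M.
    move=> [j jp Mj]; exists (lab j.-1); last by exists j.
    by have [] := lab_inv j.-1 ltac:(move: jp => /=; lia).
  by move=> [c cg [j [jp _] Mj]]; exists j.
- move=> c cg; have [rp rc] := repP c cg; split.
  + apply: closed_bigcup; last by move=> j _; exact: thread_closed.
    by apply: (sub_finite_set _ (finite_II p.+1)) => j [/andP[_ jp] _].
  + have Kthread j : (0 < j <= p)%N -> lab j.-1 = c -> thread j `<=` K c.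
      by move=> jp jc M Mj; exists j.
    pose base j : 'rV[R]_3 := pt3 j%:R 0 0.
    have step j : (0 < j <= p)%N -> lab j.-1 = c ->
        connected_component (K c) (base j) (base (word_act w j)).
      move=> jp jc; apply: (thread_component (Kthread j jp jc)).
      by left; rewrite -level_size; exact: closing_arc_bot.
    (* Membership in the class is carried in both directions, as the symmetric steps of the
       equivalence require. *)
    have orb x y : orbit_eq p (fun y => (word_act w y.+1).-1) x y ->
        ((x < p)%N /\ lab x = c <-> (y < p)%N /\ lab y = c) /\
        ((x < p)%N /\ lab x = c ->
          connected_component (K c) (base x.+1) (base y.+1)).
      elim=> [x' y' [xp ->]|x'|x' y' _ [xy cxy]|x' y' z' _ [xy cxy] _ [yz cyz]].
      - have [_ labx] := lab_inv x' xp.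
        have lt_p : ((word_act w x'.+1).-1 < p)%N.
          by have := level_range n (j := x'.+1) xp; rewrite level_size; lia.
        split; first by rewrite labx; split=> -[].
        by move=> [_ xc]; rewrite wE //; exact: step x'.+1 xp xc.
      - by split=> // -[xp xc]; apply/connected_component_refl/(Kthread x'.+1 xp xc)/thread_bot.
      - by split=> [|yc]; [exact: iff_sym|apply/connected_component_sym/cxy/xy].
      - split=> [|xc]; first exact: iff_trans yz.
        by apply: connected_component_trans (cxy xc) (cyz _); apply/xy.
    have KE : K c = connected_component (K c) (base (rep c).+1).
      apply/seteqP; split; last exact: connected_component_sub.
      move=> M [j [jp jc] Mj].
      apply: (connected_component_trans _ (thread_component (Kthread j jp jc) Mj)).
      have jp' : (j.-1 < p)%N by lia.
      apply: connected_component_sym; rewrite -[j](@prednK j); last by case/andP: jp.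
      have [_] := orb _ _ (conn j.-1 jp'); rewrite jc; exact.
    by rewrite KE; exact: component_connected.
  + exists (pt3 (rep c).+1%:R 0 0); exists (rep c).+1; last exact: thread_bot.
    by split=> //=.
- move=> b c M bg cg [i [ip <-] Mi] [j [jp <-] Mj].
  have [->//|[->|->]] := thread_disjoint ip jp Mi Mj; by rewrite labw.
Qed.

End ClosedBraid.

End Pieces.

(** * Twisted torus links *)

Local Open Scope nat_scope.

Lemma has_orbits_inverse p (f h : nat -> nat) g :
  (forall y, y < p -> h y < p /\ f (h y) = y) ->
  (forall x, x < p -> f x < p /\ h (f x) = x) ->
  has_orbits p h g -> has_orbits p f g.
Proof.
move=> hP fP [lab [rep [labP repP conn]]]; exists lab, rep; split=> // y yp.
  have [lt_g _] := labP y yp; have [fyp hfy] := fP y yp.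
  by have [_] := labP _ fyp; rewrite hfy.
elim: (conn y yp) => [x _ [xp ->]|x|x z _ IH|x z t _ IHx _ IHz].
- have [hxp fhx] := hP x xp.
  by apply: rst_sym; apply: rst_step; rewrite fhx.
- exact: rst_refl.
- exact: rst_sym.
- exact: rst_trans IHx IHz.
Qed.

(** * Permutations of twisted torus words *)

Lemma word_act_cat u v j : word_act (u ++ v) j = word_act v (word_act u j).
Proof. exact: foldl_cat. Qed.

Lemma word_act_inj w : injective (word_act w).
Proof. by elim: w => [|l w IH] i j //= /IH; exact: letter_act_inj. Qed.

Lemma word_act_inv w : cancel (word_act w) (word_act (inv_word w)).
Proof.
elim: w => [|l w IH] j //=.
rewrite /inv_word /= rev_cons -cats1 word_act_cat [word_act (rev _) _]IH.
exact: letter_actK.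
Qed.

Lemma word_act_flatten_nseq k w j :
  word_act (flatten (nseq k w)) j = iter k (word_act w) j.
Proof. by elim: k j => [|k IH] j //; rewrite /= word_act_cat IH -iterSr. Qed.

Lemma word_act_staircase a k j :
  word_act [seq (i, true) | i <- iota a k] j =
  if j == a then a + k else if a < j <= a + k then j.-1 else j.
Proof.
elim: k a j => [|k IH] a j /=.
  by rewrite addn0; case: eqP => //; case: ifP => //; lia.
rewrite [LHS]IH /letter_act /=.
case: (eqVneq j a) => [_|ja]; first by rewrite eqxx addSnnS.
case: (eqVneq j a.+1) => [->|jSa]; first by case: eqP; do 2?[case: ifP]; lia.
by rewrite (negPf jSa); do 2?[case: ifP]; lia.
Qed.

(** On positions counted from 0 a row subtracts 1 modulo [m]; evaluating it at the preimage of [x]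
    avoids truncated subtraction. *)
Lemma sigma_row_act m x : x < m -> word_act (sigma_row m) (x.+1 %% m).+1 = x.+1.
Proof.
move=> xm; rewrite word_act_staircase.
move: xm; rewrite leq_eqVlt => /orP[/eqP<-|xm]; first by rewrite modnn.
by rewrite modn_small //= ifT //; lia.
Qed.

Lemma sigma_row_act_id m x : m <= x -> word_act (sigma_row m) x.+1 = x.+1.
Proof.
move=> mx; rewrite word_act_staircase; case: eqP => [|_]; first by lia.
by rewrite ifF //; lia.
Qed.

Lemma modnS_mod x m : (x %% m).+1 %% m = x.+1 %% m.
Proof. by rewrite -addn1 modnDml addn1. Qed.

Lemma sigma_row_exp_act m k x : x < m ->
  word_act (exp_word (sigma_row m) k%:Z) ((x + k) %% m).+1 = x.+1.
Proof.
rewrite /exp_word word_act_flatten_nseq => xm.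
elim: k => [|k IH] /=; first by rewrite addn0 modn_small.
by rewrite addnS -modnS_mod -iterS iterSr sigma_row_act // ltn_pmod //; lia.
Qed.

Lemma sigma_row_exp_act_id m (k : int) x : m <= x ->
  word_act (exp_word (sigma_row m) k) x.+1 = x.+1.
Proof.
move=> mx; case: k => k; rewrite /exp_word word_act_flatten_nseq;
  apply: iter_fix; first exact: sigma_row_act_id.
(* A position fixed by a word is fixed by its inverse. *)
by rewrite -{1}(sigma_row_act_id mx) word_act_inv.
Qed.

Lemma sigma_row_expN_act m k x : x < m ->
  word_act (exp_word (sigma_row m) (- k%:Z)%R) x.+1 = ((x + k) %% m).+1.
Proof.
have iterE j : x < m ->
    iter j (word_act (inv_word (sigma_row m))) x.+1 = ((x + j) %% m).+1.
  move=> xm; elim: j => [|j IH] /=; first by rewrite addn0 modn_small.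
  have jm : (x + j) %% m < m by rewrite ltn_pmod //; lia.
  by rewrite IH -(sigma_row_act jm) word_act_inv modnS_mod addnS.
case: k => [|k] xm; first by rewrite oppr0 /= addn0 modn_small.
have -> : (- k.+1%:Z)%R = Negz k by rewrite NegzE.
by rewrite /exp_word word_act_flatten_nseq iterE.
Qed.

Lemma exp_word_strands p w (k : int) :
  all (fun l => 0 < l.1 < p) w -> all (fun l => 0 < l.1 < p) (exp_word w k).
Proof.
have flat n v : all (fun l : nat * bool => 0 < l.1 < p) v ->
    all (fun l : nat * bool => 0 < l.1 < p) (flatten (nseq n v)).
  by move=> vp; elim: n => //= n IH; rewrite all_cat vp.
move=> wp; case: k => k; apply: flat => //.
by rewrite /inv_word all_rev all_map.
Qed.

Lemma sigma_row_strands m p : m <= p -> all (fun l => 0 < l.1 < p) (sigma_row m).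
Proof.
by move=> mp; apply/allP => _ /mapP[i + ->]; rewrite mem_iota /=; lia.
Qed.

(** [B] inverts the twist on [r] strands and the rotation by [q] inverts the other factor, so their
    composite inverts the permutation of the word and has the same orbits. *)
Lemma NC_of_orbits (R : realType) p q r (s : int) (B : nat -> nat) g :
  0 < r -> r <= p ->
  (forall y, r <= y -> B y = y) ->
  (forall y, y < r -> B y < r /\ word_act (exp_word (sigma_row r) s) (B y).+1 = y.+1) ->
  has_orbits p (fun y => (B y + q) %% p) g ->
  NC R p q%:Z r s = g.
Proof.
move=> r0 rp B_id B_act orb; have p0 : 0 < p by lia.
set w := twisted_torus_word p q%:Z r s.
have w_strands : all (fun l => 0 < l.1 < p) w.
  by rewrite /w /twisted_torus_word all_cat !exp_word_strands // sigma_row_strands.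
have B_lt y : y < p -> B y < p.
  move=> yp; case: (ltnP y r) => yr; last by rewrite B_id.
  exact: leq_trans (B_act y yr).1 rp.
have wP y : y < p -> word_act w ((B y + q) %% p).+1 = y.+1.
  move=> yp; rewrite /w /twisted_torus_word word_act_cat sigma_row_exp_act ?B_lt //.
  case: (ltnP y r) => yr; first exact: (B_act y yr).2.
  by rewrite B_id // sigma_row_exp_act_id.
apply: card_components_closed_braid => //.
have hP y : y < p -> (B y + q) %% p < p /\ (word_act w ((B y + q) %% p).+1).-1 = y.
  by move=> yp; rewrite wP // ltn_pmod.
have fP x : x < p -> 0 < word_act w x.+1 <= p.
  move=> xp; rewrite -level_size; exact: level_range.
apply: has_orbits_inverse orb => // x xp; have /andP[f0 fp] := fP x xp.
have fx : (word_act w x.+1).-1 < p by lia.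
split=> //; apply/succn_inj/(@word_act_inj w).
by rewrite wP // prednK.
Qed.

Local Open Scope ring_scope.

Theorem theorem3p5 (R : realType) (p q r : nat)
    (hr : (0 < r)%N) (hrp : (r <= p)%N) (hq : (0 < q)%N)
    (hpq : (p%:Z = -1 %[mod q%:Z])%Z) :
  [/\ (1 <= r %% (2 * q) <= q)%N ->
        (NC R p q%:Z r q%:Z)%:Z = gcdz (r %% (2 * q))%N%:Z (q%:Z + 1),
      (q + 1 <= r %% (2 * q) <= 2 * q - 1)%N ->
        (NC R p q%:Z r q%:Z)%:Z = gcdz ((r %% (2 * q))%N%:Z - 2) (q%:Z - 1)
    & (r < q)%N ->
        (NC R p q%:Z r (- q%:Z))%:Z = gcdz r%:Z (1 - q%:Z)].
Proof.
have [m p1E] : exists m, p.+1 = (m * q)%N.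
  have : (q %| p.+1)%N.
    move/eqP: hpq; rewrite eqz_mod_dvd.
    by have -> : p%:Z - -1 = p.+1%:Z by lia.
  by case/dvdnP=> m; exists m.
pose rot s y := if (y < r)%N then ((y + s) %% r)%N else y.
have rot_id s y : (r <= y)%N -> rot s y = y by rewrite /rot ltnNge => ->.
have NC_pos g : has_orbits p (fun y => (rot q y + q) %% p)%N g ->
    NC R p q%:Z r q%:Z = g.
  apply: NC_of_orbits => // [y|y yr]; first exact: rot_id.
  by rewrite /rot yr ltn_pmod //; split=> //; exact: sigma_row_exp_act.
have rE : r = (2 * q * (r %/ (2 * q)) + r %% (2 * q))%N.
  by rewrite [(2 * q * _)%N]mulnC -divn_eq.
set rho := (r %% (2 * q))%N in rE *; set k := (r %/ (2 * q))%N in rE.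
split=> [/andP[rho1 rhoq]|/andP[rho1 rhoq]|rq].
- have -> : gcdz rho%:Z (q%:Z + 1) = (gcdn rho q.+1)%:Z by rewrite -addn1.
  congr Posz; apply: NC_pos; case: (posnP k) => k0.
    have rrho : r = rho by rewrite rE k0 muln0.
    by rewrite -rrho; apply: (@short_rotation_orbits p q r m q) => //; rewrite rrho.
  have qk : (2 * q <= 2 * q * k)%N by rewrite leq_pmulr.
  by apply: (@long_rotation_orbits_le p q r m _ _ _ _ _ _ k) => //; lia.
- have -> : gcdz (rho%:Z - 2) (q%:Z - 1) = (gcdn (2 * q - rho) q.-1)%:Z.
    rewrite /gcdz; have -> : `|rho%:Z - 2|%N = (rho - 2)%N by lia.
    have -> : `|q%:Z - 1|%N = q.-1 by lia.
    (* [rho - 2] and [2 * q - rho] add up to twice [q - 1]. *)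
    rewrite [in LHS]gcdnC [in RHS]gcdnC.
    by congr Posz; apply: (@gcdn_complement _ _ 2); lia.
  congr Posz; apply: NC_pos.
  by apply: (@long_rotation_orbits_gt p q r m _ _ _ _ _ _ k) => //; lia.
(* Rotating [r] points by [-q] is rotating them by the natural number [(r - 1) * q]; its successor
   and [q - 1] add up to [r * q], which gives the gcd. *)
- have -> : gcdz r%:Z (1 - q%:Z) = (gcdn r (r.-1 * q).+1)%:Z.
    rewrite /gcdz; have -> : `|1 - q%:Z|%N = q.-1 by lia.
    by congr Posz; apply: (@gcdn_complement _ _ q); case: r hr {rot rot_id hrp NC_pos rE rho k rq}; lia.
  congr Posz; apply: (@NC_of_orbits _ _ _ _ _ (rot (r.-1 * q)%N)) => //.
  + by move=> y; exact: rot_id.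
  + move=> y yr; rewrite /rot yr ltn_pmod //; split=> //.
    rewrite sigma_row_expN_act ?ltn_pmod // modnDml -addnA -mulSnr prednK //.
    by rewrite mulnC addnC modnMDl modn_small.
  + by apply: (@short_rotation_orbits p q r m) => //; exact: ltnW.
Qed.
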